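(* Let $a\in\mathbb{R}$ and $s>0$. Then the limit $$\lim_{N\to\infty}\sum_{n=1}^N(-1)^n\left(1-\frac nN\right)^2\frac{r_3(n)}{(a^2+n)^s}$$ exists and $$M_{a,s}=\lim_{N\to\infty}\sum_{n=1}^N(-1)^n\left(1-\frac nN\right)^2\frac{r_3(n)}{(a^2+n)^s}.$$
   Context: For $n\in\mathbb{N}$, $r_3(n)$ denotes the number of integer points $(i,j,k)\in\mathbb{Z}^3$ with $i^2+j^2+k^2=n$. The generalized Madelung constant $M_{a,s}$ is the value of the alternating lattice sum $$\sum_{(i,j,k)\in\mathbb{Z}^3\setminus\{0\}}\frac{(-1)^{i+j+k}}{(a^2+i^2+j^2+k^2)^s}$$ understood as summation by expanding rectangles, i.e. $$M_{a,s}:=\lim_{(I,J,K)\to\infty}\ \sum_{\substack{(i,j,k)\in\mathbb{Z}^3\setminus\{0\}\\ |i|\le I,\ |j|\le J,\ |k|\le K}}\frac{(-1)^{i+j+k}}{(a^2+i^2+j^2+k^2)^s},$$ where $I,J,K\in\mathbb{N}$ and the triple limit is taken as $\min\{I,J,K\}\to\infty$. This limit exists and is finite for every $a\in\mathbb{R}$, $s>0$. *)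

(* Defs.v *)
From mathcomp Require Import all_boot all_order all_algebra finmap.
From mathcomp Require Import all_classical all_reals all_analysis.

Set Implicit Arguments.
Unset Strict Implicit.
Unset Printing Implicit Defensive.

Import Order.TTheory GRing.Theory Num.Theory.
Import numFieldNormedType.Exports.

Local Open Scope classical_set_scope.
Local Open Scope ring_scope.

(* (i, j, k) is encoded as ((i, j), k). *)
Definition normsq (p : int * int * int) : int :=
  p.1.1 ^+ 2 + p.1.2 ^+ 2 + p.2 ^+ 2.

Definition coordsum (p : int * int * int) : int := p.1.1 + p.1.2 + p.2.

Definition sphere3 (n : nat) : set (int * int * int) :=
  [set p | normsq p = n%:Z].

(* [fset_set] and [\sum_(_ \in _)] are only meaningful on finite sets;
   see [finite_sphere3] and [finite_box3]. *)
Definition r3 (n : nat) : nat := #|` fset_set (sphere3 n)|.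

Definition box3 (b : nat * nat * nat) : set (int * int * int) :=
  [set p | p != 0 /\
    [/\ `|p.1.1| <= b.1.1%:Z, `|p.1.2| <= b.1.2%:Z & `|p.2| <= b.2%:Z]].

Lemma finite_int_itv (n : nat) : finite_set [set i : int | `|i| <= n%:Z].
Proof.
apply: (@sub_finite_set _ _ (Posz @` `I_n.+1 `|` (fun k => - Posz k) @` `I_n.+1)).
  by case=> m /= hm; [left; exists m | right; exists m.+1].
by rewrite finite_setU; split; apply: finite_image; exact: finite_II.
Qed.

Lemma finite_box3 (b : nat * nat * nat) : finite_set (box3 b).
Proof.
apply: (@sub_finite_set _ _ ([set i : int | `|i| <= b.1.1%:Z] `*`
  [set i : int | `|i| <= b.1.2%:Z] `*` [set i : int | `|i| <= b.2%:Z])).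
  by move=> p [_ [? ? ?]].
by do ![apply: finite_setX]; exact: finite_int_itv.
Qed.

Lemma finite_sphere3 (n : nat) : finite_set (sphere3 n).
Proof.
have le_sq (i : int) : `|i| <= i ^+ 2.
  rewrite -real_normK ?num_real// expr2 -abszE -PoszM lez_nat.
  by case: `|i|%N => // m; rewrite leq_pmulr.
apply: (@sub_finite_set _ _ ([set i : int | `|i| <= n%:Z] `*`
  [set i : int | `|i| <= n%:Z] `*` [set i : int | `|i| <= n%:Z])).
  move=> p; rewrite /sphere3 /normsq /= => <-.
  split=> /=; first split=> /=; apply: (le_trans (le_sq _)).
  - by rewrite -addrA lerDl addr_ge0 ?sqr_ge0.
  - by rewrite addrAC lerDr addr_ge0 ?sqr_ge0.
  - by rewrite lerDr addr_ge0 ?sqr_ge0.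
by do ![apply: finite_setX]; exact: finite_int_itv.
Qed.

Section Madelung.
Variable R : realType.
Implicit Types a s : R.

Definition madelung_box a s (b : nat * nat * nat) : R :=
  \sum_(p \in box3 b)
    (-1) ^ coordsum p / (a ^+ 2 + (normsq p)%:~R) `^ s.

(* The product filter [(\oo, \oo, \oo)] on [nat * nat * nat] is the filter
   generated by the sets of (I, J, K) with min{I, J, K} >= N. *)
Definition madelung a s : R := lim (madelung_box a s @ (\oo, \oo, \oo)).

Definition riesz_sum a s (N : nat) : R :=
  \sum_(1 <= n < N.+1)
    (-1) ^+ n * (1 - n%:R / N%:R) ^+ 2
    * ((r3 n)%:R / (a ^+ 2 + n%:R) `^ s).

End Madelung.

(* Main.v *)
Require Import Defs.
From mathcomp Require Import all_boot all_order all_algebra.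
From mathcomp Require Import all_classical all_reals all_analysis.
From mathcomp Require Import ring lra zify.
Import Order.TTheory GRing.Theory Num.Theory.
Import numFieldNormedType.Exports.
Local Open Scope classical_set_scope.
Local Open Scope ring_scope.

(* Let D = (1 - T1)(1 - T2)(1 - T3) where Ti shifts the i-th coordinate.
   Summation by parts gives, for G of finite support,
     sum_(m in Z^3) (-1)^(m1+m2+m3) G(|m1|, |m2|, |m3|)
       = sum_(m in N^3) (-1)^(m1+m2+m3) D G(m).
   When G(m) = F(m1^2 + m2^2 + m3^2) with F 3-monotone (the first three
   differences of F alternate in sign), possibly truncated to a box, D G >= 0
   away from the origin, so the part of the right-hand side outside [0, M)^3 is
   bounded by a telescoping sum, i.e. by values of F at arguments >= M^2.
   Both (a^2 + n)^-s and n |-> max(0, N - n)^2 are 3-monotone, and products of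
   3-monotone sequences are 3-monotone.  Hence the Riesz sums and the sums over
   boxes have tails bounded uniformly by a multiple of (a^2 + M^2)^-s; as they
   converge termwise to the same series, they have the same limit. *)

(** * Multiply monotone sequences and their closure properties *)

Section MultiplyMonotone.
Set Implicit Arguments.
Unset Strict Implicit.
Context {R : realFieldType}.
Implicit Types (f g : nat -> R) (k n u : nat).

Definition delta f n := f n - f n.+1.

(** A finite-order form of complete monotonicity. The sign in [delta] is chosen so that all iterated
    differences of order at most [k] are nonnegative. *)
Fixpoint kmono k f : Prop :=
  (forall n, 0 <= f n) /\ if k is k'.+1 then kmono k' (delta f) else True.

Lemma kmono_ge0 k f n : kmono k f -> 0 <= f n.
Proof. by case: k => [|k] [f_ge0 _]. Qed.

Lemma kmonoW k f : kmono k.+1 f -> kmono k f.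
Proof.
elim: k f => [|k IH] f [f_ge0 df]; first by [].
by split=> //; exact: IH.
Qed.

Lemma kmono_shift k f : kmono k f -> kmono k (fun n => f n.+1).
Proof.
elim: k f => [|k IH] f [f_ge0 df]; split=> //.
exact: (IH (delta f)).
Qed.

Lemma kmonoD k f g : kmono k f -> kmono k g -> kmono k (fun n => f n + g n).
Proof.
elim: k f g => [|k IH] f g [f_ge0 df] [g_ge0 dg].
  by split=> // n; rewrite addr_ge0.
split=> [n|]; first by rewrite addr_ge0.
rewrite (_ : delta _ = fun n => delta f n + delta g n); first exact: IH.
by apply/funext => n; rewrite /delta; ring.
Qed.

Lemma kmono0 k : kmono k (fun=> 0).
Proof.
elim: k => [|k IH]; split=> //.
by rewrite (_ : delta _ = fun=> 0)//; apply/funext => n; rewrite /delta subrr.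
Qed.

Lemma kmono_const k (c : R) : 0 <= c -> kmono k (fun=> c).
Proof.
case: k => [|k] c0; split=> //.
rewrite (_ : delta _ = fun=> 0); first exact: kmono0.
by apply/funext => n; rewrite /delta subrr.
Qed.

(** Discrete Leibniz rule: [delta] of a product is a sum of two products to which the induction
    hypothesis applies. *)
Lemma kmonoM k f g : kmono k f -> kmono k g -> kmono k (fun n => f n * g n).
Proof.
elim: k f g => [|k IH] f g kf kg.
  by split=> // n; rewrite mulr_ge0// (@kmono_ge0 0).
split=> [n|]; first by rewrite mulr_ge0// (@kmono_ge0 k.+1).
rewrite (_ : delta _ = fun n => f n * delta g n + delta f n * g n.+1).
  apply: kmonoD.
    by apply: IH; [exact: kmonoW | case: kg].
  by apply: (IH (delta f) (fun n => g n.+1));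
    [case: kf | apply: kmono_shift; exact: kmonoW].
by apply/funext => n; rewrite /delta; ring.
Qed.

Definition gapdiff u f n := f n - f (n + u)%N.

(** A gap of length [u] telescopes into [u] unit differences, each a shift of [delta f]. Long gaps
    arise because a unit step in one coordinate changes the squared norm by an odd number. *)
Lemma kmono_gapdiff k u f : kmono k.+1 f -> kmono k (gapdiff u f).
Proof.
move=> kf; elim: u => [|u IH].
  rewrite (_ : gapdiff _ _ = fun=> 0); first exact: kmono0.
  by apply/funext => n; rewrite /gapdiff addn0 subrr.
rewrite (_ : gapdiff _ _ = fun n => gapdiff u f n + delta f (n + u)%N).
  apply: kmonoD => //; elim: u {IH} => [|u IH].
    rewrite (_ : (fun n => _) = delta f); first by case: kf.
    by apply/funext => n; rewrite addn0.
  rewrite (_ : (fun n => _) = fun n => delta f (n.+1 + u)%N).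
    exact: (kmono_shift IH).
  by apply/funext => n; rewrite addnS.
by apply/funext => n; rewrite /gapdiff /delta addnS; ring.
Qed.

(** Truncated subtraction makes this max(0, N - n)^2. The square matters: for N >= 2, max(0, N - n)
    itself has a third difference equal to -1 at n = N - 2. *)
Lemma kmono_sqr_subn N : kmono 3 (fun n => (N - n)%N%:R ^+ 2 : R).
Proof.
have E q : delta (fun n => (N - n)%N%:R ^+ 2 : R) q =
    ((N - q) + (N - q).-1)%N%:R.
  rewrite /delta subnS; case: (N - q)%N => [|m] /=; rewrite ?subrr//.
  by rewrite natrD -natr1; ring.
have E2 q : delta (delta (fun n => (N - n)%N%:R ^+ 2 : R)) q =
    (minn (N - q) 2)%:R.
  rewrite {1}/delta !E subnS; case: (N - q)%N => [|[|m]] /=.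
  - by rewrite subrr.
  - by rewrite !addn0 subr0.
  - by rewrite -natrB; [congr (_%:R); lia|lia].
have E3 q : delta (delta (delta (fun n => (N - n)%N%:R ^+ 2 : R))) q =
    (minn (N - q) 2 - minn (N - q.+1) 2)%N%:R.
  by rewrite {1}/delta !E2 natrB//; lia.
split; first by move=> n; rewrite sqr_ge0.
split; first by move=> n; rewrite E.
split; first by move=> n; rewrite E2.
by split=> // n; rewrite E3.
Qed.

End MultiplyMonotone.

(** * Monotonicity of negative powers *)

Section Power.
Set Implicit Arguments.
Unset Strict Implicit.
Context {R : realType}.
Implicit Types (s x : R) (k n : nat).

(** The differences keep a real argument [x], so that calculus applies to them. *)
Fixpoint powdiff k s x : R :=
  if k is k'.+1 then powdiff k' s x - powdiff k' s (x + 1) else x `^ (- s).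

(** Differentiation commutes with differencing, so only the exponent moves. *)
Lemma is_derive_powdiff k s x : 0 < x ->
  is_derive x 1 (powdiff k s) (- s * powdiff k (s + 1) x).
Proof.
elim: k x => [|k IH] x x0 /=.
  rewrite (_ : - (s + 1) = - s - 1); last by ring.
  exact: is_derive1_powR.
have := IH _ x0; have /IH : 0 < x + 1 by lra.
move=> d1 d0.
have d2 : is_derive x 1 (fun y => powdiff k s (y + 1))
    (- s * powdiff k (s + 1) (x + 1)).
  rewrite -[- s * _]mulr1.
  apply: (@is_derive1_comp _ (powdiff k s) (fun y => y + 1)) => //.
  by apply: is_derive_eq; rewrite addr0.
rewrite mulrBr; exact: is_deriveB d0 d2.
Qed.

(** By the mean value theorem the difference of order k + 1 at [x] is [s * powdiff k (s + 1) c] for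
    some [c] in between; the induction therefore ranges over all exponents. *)
Lemma powdiff_ge0 k s x : 0 <= s -> 0 < x -> 0 <= powdiff k s x.
Proof.
elim: k s x => [|k IH] s x s0 x0 /=; first exact: powR_ge0.
rewrite subr_ge0.
have [c cI E] : exists2 c, c \in `]x, x + 1[%R & powdiff k s (x + 1) - powdiff k s x
  = (- s * powdiff k (s + 1) c) * (x + 1 - x).
  apply: (@MVT _ (powdiff k s) (fun y => - s * powdiff k (s + 1) y)).
  - by rewrite ltrDl.
  - move=> y; rewrite in_itv /= => /andP[xy _].
    by apply: is_derive_powdiff; lra.
  - apply: derivable_within_continuous => y; rewrite in_itv /= => /andP[xy _].
    have y0 : 0 < y by lra.
    by have [] := is_derive_powdiff k s y0.
have c0 : 0 < c by move: cI; rewrite in_itv/=; lra.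
have : 0 <= s * powdiff k (s + 1) c by rewrite mulr_ge0// IH//; lra.
by rewrite -subr_le0 E; lra.
Qed.

Lemma kmono_powR k s x : 0 <= s -> 0 < x -> kmono k (fun n => (x + n%:R) `^ (- s)).
Proof.
move=> s0 x0.
have x0n n : 0 < x + n%:R by rewrite ltr_wpDr.
(* Applying [delta] raises [l] by one, so the induction on [k] needs every [l]. *)
suff H l : kmono k (fun n => powdiff l s (x + n%:R)) by exact: (H 0).
elim: k l => [|k IH] l.
  by split=> // n; exact: powdiff_ge0.
split=> [n|]; first exact: powdiff_ge0.
rewrite (_ : delta _ = fun n => powdiff l.+1 s (x + n%:R)); first exact: IH.
by apply/funext => n; rewrite /delta -natr1 addrA.
Qed.

End Power.

(** * Mixed differences on the octant and their tails *)

Section Lattice.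
Set Implicit Arguments.
Unset Strict Implicit.
Context {R : realFieldType}.
Implicit Types (F : nat -> R) (G H : nat -> nat -> nat -> R) (i j k M P : nat).
Implicit Types b : nat * nat * nat.

Definition nsq i j k := (i ^ 2 + j ^ 2 + k ^ 2)%N.

Definition boxed b F i j k : R :=
  if [&& i <= b.1.1, j <= b.1.2 & k <= b.2]%N then F (nsq i j k) else 0.

Definition mixdiff G i j k :=
  delta (fun k' => delta (fun j' => delta (fun i' => G i' j' k') i) j) k.

Definition cubesum H P := \sum_(i < P) \sum_(j < P) \sum_(k < P) H i j k.

Lemma nsq_eq0 i j k : (nsq i j k == 0)%N = [&& i == 0, j == 0 & k == 0]%N.
Proof. by rewrite !addn_eq0 !expn_eq0 !andbT andbA. Qed.

Lemma boxed_ge0 b F i j k : (forall n, 0 <= F n) -> 0 <= boxed b F i j k.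
Proof. by move=> F0; rewrite /boxed; case: ifP. Qed.

Lemma boxed_le b F i j k : (forall n, 0 <= F n) -> boxed b F i j k <= F (nsq i j k).
Proof. by move=> F0; rewrite /boxed; case: ifP. Qed.

(* Where a coordinate of (i, j, k) sits on the face of the box, the truncation
   turns the difference in that direction into an evaluation, so only the
   differences in the remaining directions are left. *)
Lemma mixdiff_boxed_ge0 b F i j k : kmono 3 (fun n => F n.+1) ->
  ~~ [&& i == 0, j == 0 & k == 0]%N -> 0 <= mixdiff (boxed b F) i j k.
Proof.
(* Monotonicity of [F] is known only from 1 on; away from the origin the argument has the form
   [x.+1]. *)
move=> kF; rewrite -nsq_eq0; case E : (nsq i j k) => [//|x] _.
(* These are the increments (i + 1)^2 - i^2 = 2 i + 1. *)
pose u := i.*2.+1; pose v := j.*2.+1; pose w := k.*2.+1.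
have nsqi j' k' : nsq i.+1 j' k' = (nsq i j' k' + u)%N by rewrite /nsq; lia.
have nsqj i' k' : nsq i' j.+1 k' = (nsq i' j k' + v)%N by rewrite /nsq; lia.
have nsqk i' j' : nsq i' j' k.+1 = (nsq i' j' k + w)%N by rewrite /nsq; lia.
have k2 u1 := kmono_gapdiff u1 kF.
have k1 u1 u2 := kmono_gapdiff u2 (k2 u1).
have k0 u1 u2 u3 := kmono_gapdiff u3 (k1 u1 u2).
(* One inequality for each set of directions still being differenced: all three, two, one, none.
   Beyond a face everything is 0. *)
have := kmono_ge0 x (k0 w v u).
have := (kmono_ge0 x (k1 v u), kmono_ge0 x (k1 w u), kmono_ge0 x (k1 w v)).
have := (kmono_ge0 x (k2 u), kmono_ge0 x (k2 v), kmono_ge0 x (k2 w)).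
have := kmono_ge0 x kF.
rewrite /gapdiff -!addSn -!E => H0 [[Hu Hv] Hw] [[Huv Huw] Hvw] H3.
rewrite /mixdiff /delta /boxed !(nsqk, nsqj, nsqi).
case: (ltngtP i b.1.1) => _ /=; case: (ltngtP j b.1.2) => _ /=;
  case: (ltngtP k b.2) => _ /=.
all: lra.
Qed.

Lemma sum_delta (g : nat -> R) P : \sum_(i < P) delta g i = g 0%N - g P.
Proof.
elim: P => [|P IH]; first by rewrite big_ord0 subrr.
by rewrite big_ord_recr /= IH /delta; ring.
Qed.

(** Telescoping in each coordinate leaves the eight corners, signed by the parity of the number of
    coordinates equal to [P]. *)
Lemma cubesum_mixdiff G P : cubesum (mixdiff G) P =
  G 0 0 0 - G P 0 0 - G 0 P 0 - G 0 0 P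
  + G P P 0 + G P 0 P + G 0 P P - G P P P.
Proof.
rewrite /cubesum /mixdiff.
under eq_bigr do under eq_bigr do rewrite sum_delta /=.
under eq_bigr do rewrite sumrB !sum_delta /=.
by rewrite 2!sumrB 2!sum_delta sumrB !sum_delta; ring.
Qed.

Definition sgnsum G := cubesum (fun i j k => (-1) ^+ (i + j + k) * mixdiff G i j k).

(** Extension by zero puts sums over two cubes on the same index set, so that they can be subtracted
    termwise. *)
Lemma cubesum_widen H M P : (M <= P)%N -> cubesum H M =
  cubesum (fun i j k => if [&& i < M, j < M & k < M]%N then H i j k else 0) P.
Proof.
move=> MP; rewrite /cubesum (big_ord_widen P (fun i => \sum_(j < M) \sum_(k < M) H i j k))//.
rewrite big_mkcond; apply: eq_bigr => i _; case: ltnP => _ /=; last first.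
  by rewrite big1// => j _; rewrite big1.
rewrite (big_ord_widen P (fun j => \sum_(k < M) H i j k))//.
rewrite big_mkcond; apply: eq_bigr => j _; case: ltnP => _ /=; last by rewrite big1.
by rewrite (big_ord_widen P (H i j))// big_mkcond.
Qed.

Lemma cubesumB H H' P :
  cubesum H P - cubesum H' P = cubesum (fun i j k => H i j k - H' i j k) P.
Proof.
rewrite /cubesum -sumrB; apply: eq_bigr => i _.
by rewrite -sumrB; apply: eq_bigr => j _; rewrite -sumrB.
Qed.

Lemma cubesum_ler_norm H H' P : (forall i j k, `|H i j k| <= H' i j k) ->
  `|cubesum H P| <= cubesum H' P.
Proof.
move=> HH'; apply: (le_trans (ler_norm_sum _ _ _)); apply: ler_sum => i _.
apply: (le_trans (ler_norm_sum _ _ _)); apply: ler_sum => j _.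
by apply: (le_trans (ler_norm_sum _ _ _)); apply: ler_sum.
Qed.

(** Since M > 0, the origin lies in the smaller cube; on the rest [mixdiff G] is its own absolute
    value. *)
Lemma sgnsum_tail_le G M P : (0 < M)%N -> (M <= P)%N ->
  (forall i j k, ~~ [&& i == 0, j == 0 & k == 0]%N -> 0 <= mixdiff G i j k) ->
  `|sgnsum G P - sgnsum G M| <= cubesum (mixdiff G) P - cubesum (mixdiff G) M.
Proof.
move=> M0 MP G0; rewrite /sgnsum (cubesum_widen _ MP) (cubesum_widen (mixdiff G) MP).
rewrite !cubesumB; apply: cubesum_ler_norm => i j k.
case: ifPn => [_|ijkM]; first by rewrite !subrr normr0.
rewrite !subr0 normrM normrX normrN1 expr1n mul1r ger0_norm// G0//.
by apply: contra ijkM => /and3P[/eqP-> /eqP-> /eqP->]; rewrite M0.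
Qed.

(** Corners involving [P] lie outside the box and vanish, the values at the origin cancel, and
    corners with two coordinates [M] enter negatively and are dropped. Bounding by [f] makes the
    estimate uniform over all [F] below [f]. *)
Lemma sgnsum_boxed_tail F f b M P : F 0%N = 0 -> kmono 3 (fun n => F n.+1) ->
  (forall n, F n <= f n) -> (0 < M)%N -> (M <= P)%N ->
  [&& b.1.1 < P, b.1.2 < P & b.2 < P]%N ->
  `|sgnsum (boxed b F) P - sgnsum (boxed b F) M| <=
    3 * f (M ^ 2)%N + f (3 * M ^ 2)%N.
Proof.
move=> F0 kF Ff M0 MP /and3P[b1 b2 b3].
have F_ge0 n : 0 <= F n by case: n => [|n]; rewrite ?F0//; exact: (kmono_ge0 n kF).
apply: (le_trans (sgnsum_tail_le M0 MP _)).
  by move=> i j k; exact: mixdiff_boxed_ge0.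
rewrite !cubesum_mixdiff.
have bP1 j k : boxed b F P j k = 0 by rewrite /boxed leqNgt b1.
have bP2 i k : boxed b F i P k = 0 by rewrite /boxed (leqNgt P) b2 andbF.
have bP3 i j : boxed b F i j P = 0 by rewrite /boxed (leqNgt P) b3 !andbF.
rewrite !(bP1, bP2, bP3).
have up i j k n : nsq i j k = n -> boxed b F i j k <= f n.
  by move=> <-; apply: (le_trans (boxed_le _ _ _ _ F_ge0)).
have := up M 0%N 0%N (M ^ 2)%N; have := up 0%N M 0%N (M ^ 2)%N.
have := up 0%N 0%N M (M ^ 2)%N; have := up M M M (3 * M ^ 2)%N.
do 4![move=> /(_ ltac:(rewrite /nsq; lia))-?].
have := boxed_ge0 b M M 0 F_ge0; have := boxed_ge0 b M 0 M F_ge0.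
by have := boxed_ge0 b 0 M M F_ge0; lra.
Qed.

(** * Folding sums over Z^3 onto the octant *)

Definition ints P : seq int := map Posz (iota 0 P.+1) ++ map Negz (iota 0 P).

Lemma mem_ints P (z : int) : (z \in ints P) = (`|z| <= P)%N.
Proof.
have Pinj : injective Posz by move=> ? ? [].
have Ninj : injective Negz by move=> ? ? [].
rewrite mem_cat; case: z => n; rewrite (mem_map Pinj, mem_map Ninj) mem_iota.
  by case: (mapP (s := iota 0 P)) => [[? _ //]|_]; rewrite orbF ltnS.
by case: (mapP (s := iota 0 P.+1)) => [[? _ //]|_].
Qed.

Lemma uniq_ints P : uniq (ints P).
Proof.
rewrite cat_uniq !map_inj_uniq ?iota_uniq ?andbT /=; [|by move=> ? ? []..].
by apply/hasPn => _ /mapP[n _ ->]; apply/mapP => -[].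
Qed.

(** Both sides equal g(0) plus twice the sum of (-1)^i g(i) for 1 <= i <= P. *)
Lemma sum_ints (g : nat -> R) P : g P.+1 = 0 ->
  \sum_(z <- ints P) (-1) ^+ `|z|%N * g `|z|%N =
  \sum_(i < P.+1) (-1) ^+ i * delta g i.
Proof.
move=> gP.
have iotaE (h : nat -> R) n : \sum_(i <- iota 0 n) h i = \sum_(i < n) h i.
  by rewrite -(big_mkord predT) /index_iota subn0.
rewrite big_cat !big_map !iotaE /=.
(* With the boundary term restored the identity holds for every [g], which lets the induction on [P]
   run. *)
transitivity (\sum_(i < P.+1) (-1) ^+ i * delta g i + (-1) ^+ P * g P.+1);
  last by rewrite gP mulr0 addr0.
elim: P {gP} => [|P IH]; first by rewrite !big_ord_recr !big_ord0 /= /delta; ring.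
rewrite big_ord_recr [X in _ + X]big_ord_recr [in RHS]big_ord_recr /=.
rewrite addrACA IH /delta !exprS; ring.
Qed.

Definition cube P : seq (int * int * int) :=
  [seq (q, z) | q <- [seq (x, y) | x <- ints P, y <- ints P], z <- ints P].

Definition absnsq (p : int * int * int) := nsq `|p.1.1| `|p.1.2| `|p.2|.

Lemma mem_cube P p :
  (p \in cube P) = [&& `|p.1.1| <= P, `|p.1.2| <= P & `|p.2| <= P]%N.
Proof.
case: p => -[x y] z; apply/idP/idP => /=.
  case/allpairsPdep => -[x' y'] [z' [/allpairsPdep[x2 [y2 [+ + [-> ->]]]] + [-> -> ->]]].
  by rewrite !mem_ints => -> -> ->.
case/and3P => xP yP zP; apply/allpairsPdep; exists (x, y), z; rewrite mem_ints; split=> //.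
by apply/allpairsPdep; exists x, y; rewrite !mem_ints.
Qed.

Lemma uniq_cube P : uniq (cube P).
Proof.
apply: allpairs_uniq; [apply: allpairs_uniq| |]; rewrite ?uniq_ints//.
- by move=> [? ?] [? ?] _ _ /= [-> ->].
- by move=> [? ?] [? ?] _ _ /= [-> ->].
Qed.

Lemma normsqE p : normsq p = (absnsq p)%:Z.
Proof. by rewrite /normsq /absnsq /nsq; lia. Qed.

Lemma sgn_nsq i j k : (-1) ^+ nsq i j k = (-1) ^+ i * (-1) ^+ j * (-1) ^+ k :> R.
Proof. by rewrite -!exprD -signr_odd -[RHS]signr_odd !oddD !oddX. Qed.

Lemma sgn_coordsum p : (-1) ^ coordsum p = (-1) ^+ absnsq p :> R.
Proof.
have E (z : int) : (-1) ^ z = (-1) ^+ `|z|%N :> R.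
  by case: z => n //; rewrite NegzE -exprnN -exprVn invrN1.
by rewrite sgn_nsq /coordsum !expfzDr ?oppr_eq0 ?oner_eq0// !E.
Qed.

(** The one-dimensional identity [sum_ints] is applied to the third, second and first coordinate in
    turn. *)
Lemma sum_cube G P : (forall j k, G P.+1 j k = 0) -> (forall i k, G i P.+1 k = 0) ->
  (forall i j, G i j P.+1 = 0) ->
  \sum_(p <- cube P) (-1) ^+ absnsq p * G `|p.1.1|%N `|p.1.2|%N `|p.2|%N =
  sgnsum G P.+1.
Proof.
move=> G1 G2 G3; rewrite /sgnsum /cubesum big_allpairs big_allpairs /=.
under eq_bigr => x _ do under eq_bigr => y _ do under eq_bigr => z _ do
  rewrite /absnsq /= sgn_nsq -mulrA.
under eq_bigr => x _ do under eq_bigr => y _ do rewrite -mulr_sumr sum_ints//.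
under eq_bigr => x _ do under eq_bigr => y _ do rewrite -mulrA mulr_sumr.
under eq_bigr => x _ do rewrite -mulr_sumr exchange_big /=.
under [RHS]eq_bigr => i _ do rewrite exchange_big /=.
rewrite [RHS]exchange_big /=.
under eq_bigr => x _ do rewrite mulr_sumr.
rewrite exchange_big /=; apply: eq_bigr => k _.
under eq_bigr => x _ do under eq_bigr => y _ do rewrite mulrCA.
under eq_bigr => x _.
  rewrite -mulr_sumr (@sum_ints (fun j => delta (G `|x|%N j) k)); last first.
    by rewrite /delta !G2 subrr.
  rewrite mulrCA mulr_sumr mulr_sumr.
  over.
rewrite exchange_big [RHS]exchange_big /=; apply: eq_bigr => j _.
under eq_bigr => x _ do rewrite [(-1) ^+ `|x|%N * _]mulrCA (mulrA (_ ^+ k)).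
rewrite -mulr_sumr (@sum_ints (fun i => delta (fun j => delta (G i j) k) j));
  last by rewrite /delta !G1 !subrr.
rewrite mulr_sumr; apply: eq_bigr => i _.
(* The differences are nested here in the opposite order to [mixdiff]; expanding both shows that
   they agree. *)
rewrite !exprD /mixdiff /delta; ring.
Qed.

Lemma box3_cube b P : (b.1.1 <= P)%N -> (b.1.2 <= P)%N -> (b.2 <= P)%N ->
  box3 b = [set` [seq p <- cube P | (absnsq p != 0)%N &&
    [&& `|p.1.1| <= b.1.1, `|p.1.2| <= b.1.2 & `|p.2| <= b.2]%N]].
Proof.
move=> b1 b2 b3.
suff memE p : p \in [seq p <- cube P | (absnsq p != 0)%N &&
    [&& `|p.1.1| <= b.1.1, `|p.1.2| <= b.1.2 & `|p.2| <= b.2]%N] <-> box3 b p.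
  by apply/seteqP; split => p /memE.
rewrite mem_filter mem_cube; case: p => -[x y] z; rewrite [absnsq _ == _]nsq_eq0 /=.
rewrite !absz_eq0; split => [/andP[/andP[p0 /and3P[xb yb zb]] _]|].
  split; last by split=> /=; lia.
  by apply: contra p0 => /eqP[-> -> ->].
move=> [p0 [/= xb yb zb]]; rewrite -andbA; apply/and3P; split; [|lia..].
by apply: contra p0 => /and3P[/eqP-> /eqP-> /eqP->].
Qed.

(** The origin is missing from [box3] but present in the cube; [F 0 = 0] reconciles the two. *)
Lemma sum_box3 F b P : F 0%N = 0 ->
  (b.1.1 <= P)%N -> (b.1.2 <= P)%N -> (b.2 <= P)%N ->
  \sum_(p \in box3 b) (-1) ^+ absnsq p * F (absnsq p) = sgnsum (boxed b F) P.+1.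
Proof.
move=> F0 b1 b2 b3; rewrite (box3_cube b1 b2 b3) -fsbig_seq ?filter_uniq ?uniq_cube//.
rewrite -sum_cube; first last.
- by move=> i j; rewrite /boxed ltnNge b3 !andbF.
- by move=> i k; rewrite /boxed (ltnNge P) b2 andbF.
- by move=> j k; rewrite /boxed (ltnNge P) b1.
rewrite big_filter big_mkcond; apply: eq_bigr => p _ /=.
rewrite /boxed -/(absnsq p); case: ifPn; first by case/andP=> _ ->.
rewrite negb_and negbK => /orP[/eqP->|/negPf ->]; last by rewrite mulr0.
by case: ifP; rewrite ?F0 mulr0.
Qed.

Lemma r3_count n N : (n <= N)%N -> r3 n = count (fun p => absnsq p == n) (cube N).
Proof.
move=> nN; rewrite /r3 -size_filter; apply: perm_size.
apply: uniq_perm; rewrite ?fset_uniq ?filter_uniq ?uniq_cube// => -[[x y] z].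
rewrite in_fset_set; last exact: finite_sphere3.
rewrite mem_filter mem_cube /=; apply/idP/idP.
  rewrite inE /sphere3 /= normsqE => -[E]; rewrite E eqxx /=.
  (* Each coordinate satisfies |x| <= x^2 <= n <= N, so the whole sphere lies in the cube. *)
  by move: E; rewrite /absnsq /nsq /=; nia.
by move=> /andP[/eqP E _]; rewrite inE /sphere3 /= normsqE E.
Qed.

(** Exchanging the sums groups lattice points by squared norm; cube points outside the ball
    contribute 0. *)
Lemma sum_r3 (c : nat -> R) N :
  \sum_(1 <= n < N.+1) c n * (r3 n)%:R =
  \sum_(p <- cube N) if (0 < absnsq p <= N)%N then c (absnsq p) else 0.
Proof.
transitivity (\sum_(1 <= n < N.+1) \sum_(p <- cube N) if absnsq p == n then c n else 0).
  apply: eq_big_nat => n /andP[_ nN].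
  rewrite (r3_count (N := N))// -sum1_count natr_sum mulr_sumr big_mkcond.
  by apply: eq_bigr => p _; rewrite mulr1.
rewrite exchange_big /=; apply: eq_bigr => p _.
rewrite -big_mkcond; under eq_bigl do rewrite eq_sym; exact: big_nat1_eq.
Qed.

End Lattice.

(** * A common limit for all admissible families of weights *)

Section Limit.
Set Implicit Arguments.
Unset Strict Implicit.
Context {R : realType}.
Implicit Types (F f : nat -> R) (b : nat * nat * nat) (M N : nat).

Definition boxsum b F := \sum_(p \in box3 b) (-1) ^+ absnsq p * F (absnsq p).

Definition octsum M F := sgnsum (fun i j k => F (nsq i j k)) M.

(** Differences at indices below [M] read values at indices up to [M] only, so the truncation is not
    seen. *)
Lemma sgnsum_boxed_inside b F M :
  (M <= b.1.1)%N -> (M <= b.1.2)%N -> (M <= b.2)%N ->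
  sgnsum (boxed b F) M = octsum M F.
Proof.
move=> b1 b2 b3; rewrite /octsum /sgnsum /cubesum.
apply: eq_bigr => i _; apply: eq_bigr => j _; apply: eq_bigr => k _.
have := ltn_ord i; have := ltn_ord j; have := ltn_ord k => kM jM iM.
have E i' j' k' : (i' <= M)%N -> (j' <= M)%N -> (k' <= M)%N ->
    boxed b F i' j' k' = F (nsq i' j' k').
  move=> i'M j'M k'M; rewrite /boxed.
  by rewrite (leq_trans i'M) ?(leq_trans j'M) ?(leq_trans k'M).
by rewrite /mixdiff /delta !E ?(ltnW iM) ?(ltnW jM) ?(ltnW kM).
Qed.

Lemma boxsum_octsum_le b F f M e : F 0%N = 0 -> kmono 3 (fun n => F n.+1) ->
  (forall n, F n <= f n) -> (0 < M)%N ->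
  (M <= b.1.1)%N -> (M <= b.1.2)%N -> (M <= b.2)%N ->
  (forall n, (M <= n)%N -> f n <= e) -> `|boxsum b F - octsum M F| <= 4 * e.
Proof.
move=> F0 kF Ff M0 b1 b2 b3 fe.
pose P := (b.1.1 + b.1.2 + b.2)%N.
rewrite /boxsum (@sum_box3 _ _ _ P)//; try by rewrite /P; lia.
rewrite -(@sgnsum_boxed_inside b)//.
apply: (le_trans (sgnsum_boxed_tail F0 kF Ff M0 _ _)); [by rewrite /P; lia..|].
have M2 : (M <= M ^ 2)%N by rewrite -{1}(expn1 M) leq_pexp2l.
by have := fe _ M2; have := fe _ (leq_trans M2 (leq_pmull _ (isT : 0 < 3)%N)); lra.
Qed.

Lemma cvg_octsum (T : Type) (Phi : set_system T) {FF : ProperFilter Phi}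
    (Fl : T -> nat -> R) f M : (forall n, Fl t n @[t --> Phi] --> f n) ->
  octsum M (Fl t) @[t --> Phi] --> octsum M f.
Proof.
move=> Ff; rewrite /octsum /sgnsum /cubesum.
do 3![apply: cvg_big => [|? _]; first exact: add_continuous].
by apply: cvgMr; rewrite /mixdiff /delta; do ![apply: cvgB].
Qed.

(** [L] is the limit of [octsum M f], fixed before the filter, the boxes and the weights, so that
    different summation methods share it. *)
Lemma boxsum_cvg (f : nat -> R) : f 0%N = 0 -> kmono 3 (fun n => f n.+1) ->
  f n @[n --> \oo] --> 0 ->
  exists L : R, forall (T : Type) (Phi : set_system T), ProperFilter Phi ->
  forall (b : T -> nat * nat * nat) (Fl : T -> nat -> R),
  (forall n, \forall t \near Phi, [/\ n <= (b t).1.1, n <= (b t).1.2 & n <= (b t).2]%N) ->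
  (forall n, Fl t n @[t --> Phi] --> f n) ->
  (forall t, [/\ Fl t 0%N = 0, kmono 3 (fun n => Fl t n.+1) & forall n, Fl t n <= f n]) ->
  boxsum (b t) (Fl t) @[t --> Phi] --> L.
Proof.
move=> f0 kf fcvg.
have fe e : 0 < e -> exists2 M, (0 < M)%N & forall n, (M <= n)%N -> f n <= e.
  move=> e0; have /cvgr0_norm_le /(_ _ e0) [M _ HM] := fcvg.
  exists M.+1 => // n Mn; apply: (le_trans (ler_norm _)).
  by apply: HM => /=; exact: ltnW.
have octe e : 0 < e -> exists2 M, (0 < M)%N &
    forall m n, (M <= m)%N -> (M <= n)%N -> `|octsum m f - octsum n f| <= e.
  move=> e0; have /fe[M M0 HM] : 0 < e / 8 by lra.
  (* One box containing both octant cubes is compared with each of them. *)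
  exists M => // m n Mm Mn; pose b := (m + n, m + n, m + n)%N.
  have H k : (M <= k)%N -> (k <= m + n)%N ->
      `|boxsum b f - octsum k f| <= 4 * (e / 8).
    move=> Mk kmn; apply: (@boxsum_octsum_le b f f) => //.
      exact: leq_trans Mk.
    by move=> l kl; apply: HM; exact: leq_trans kl.
  have := H m Mm (leq_addr _ _); have := H n Mn (leq_addl _ _).
  by rewrite !ler_norml; lra.
have [L octL] : exists L : R, octsum M f @[M --> \oo] --> L.
  have cau : cauchy_ex (octsum M f @[M --> \oo]).
    move=> e e0; have /octe[M M0 HM] : 0 < e / 2 by lra.
    exists (octsum M f); exists M => // n /= Mn.
    by apply: (le_lt_trans (HM _ _ (leqnn _) Mn)); lra.
  have : cvg (octsum M f @[M --> \oo]) by apply/cauchy_cvgP/cauchy_exP.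
  by exists (lim (octsum M f @[M --> \oo])).
exists L => T Phi FF b Fl b_oo Flf HF; apply/cvgrPdist_le => e e0.
(* Error budget: e/4 from [L] to [octsum M f], e/4 from there to [octsum M (Fl t)], and 4 * (e/16)
   for the tail. *)
have /fe[M1 M10 HM1] : 0 < e / 16 by lra.
have e4 : 0 < e / 4 by lra.
have /cvgrPdist_le/(_ _ e4) [M2 _ HM2] := octL.
pose M := (M1 + M2)%N.
have {HM2} HM2 : `|L - octsum M f| <= e / 4 by apply: HM2; exact: leq_addl.
have /cvgrPdist_le/(_ _ e4) octM := @cvg_octsum _ _ FF Fl f M Flf.
near=> t.
have [b1 b2 b3] : [/\ M <= (b t).1.1, M <= (b t).1.2 & M <= (b t).2]%N by near: t.
have [Ft0 kFt Ftf] := HF t.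
have H1 : `|octsum M f - octsum M (Fl t)| <= e / 4 by near: t.
have H2 : `|boxsum (b t) (Fl t) - octsum M (Fl t)| <= 4 * (e / 16).
  apply: (@boxsum_octsum_le _ _ f) => //; first by rewrite /M; lia.
  by move=> n Mn; apply: HM1; rewrite /M in Mn; lia.
move: HM2 H1 H2; rewrite !ler_norml; lra.
Unshelve. all: by end_near. Qed.

End Limit.

(** * The weights of the Madelung and Riesz sums *)

Section Weights.
Set Implicit Arguments.
Unset Strict Implicit.
Context {R : realType} (a s : R) (s0 : 0 < s).

(* The origin is left out of the lattice sums: for a = 0 the formula for n = 0
   would be junk. *)
Definition weight (n : nat) : R := if n == 0%N then 0 else (a ^+ 2 + n%:R) `^ (- s).

Lemma kmono_weight : kmono 3 (fun n => weight n.+1).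
Proof.
rewrite (_ : (fun n => _) = fun n => (a ^+ 2 + 1 + n%:R) `^ (- s)).
  by apply: kmono_powR; [exact: ltW | rewrite ltr_wpDl ?sqr_ge0].
by apply/funext => n; rewrite /weight /= -addrA [1 + _]addrC natr1.
Qed.

Lemma cvg_weight : weight n @[n --> \oo] --> 0.
Proof.
apply/cvgr0Pnorm_le => e e0.
near=> n.
have n0 : (0 < n)%N by near: n; exact: nbhs_infty_gt.
have nR : 0 < n%:R :> R by rewrite ltr0n.
(* This threshold is the solution of n^(-s) = e. *)
have nl : e `^ (- s^-1) <= n%:R.
  near: n; exact: nbhs_infty_ger.
rewrite /weight eqn0Ngt n0 /= ger0_norm ?powR_ge0// powRN.
have an : 0 < a ^+ 2 + n%:R by rewrite ltr_wpDl ?sqr_ge0.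
rewrite -[leRHS]invrK lef_pV2 ?posrE ?invr_gt0 ?powR_gt0//.
have -> : e^-1 = (e `^ (- s^-1)) `^ s.
  by rewrite -powRrM mulNr mulVf ?gt_eqF// powR_inv1 ?ltW.
apply: ge0_ler_powR; rewrite ?nnegrE ?powR_ge0 ?(ltW s0) ?(ltW an)//.
by apply: (le_trans nl); rewrite lerDr sqr_ge0.
Unshelve. all: by end_near. Qed.

(** The factor is (1 - n/N)^2 cut off to 0 beyond n = N, in a form to which [kmono_sqr_subn]
    applies. *)
Definition riesz_weight N n : R := weight n * ((N - n)%N%:R ^+ 2 * (N%:R ^+ 2)^-1).

Lemma riesz_weight_le N n : riesz_weight N n <= weight n.
Proof.
have w0 : 0 <= weight n by rewrite /weight; case: eqP => // _; exact: powR_ge0.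
rewrite /riesz_weight ler_piMr//.
case: N => [|N]; first by rewrite sub0n expr0n mul0r.
by rewrite ler_pdivrMr ?exprn_gt0 ?ltr0n// mul1r -!natrX ler_nat leq_exp2r ?leq_subr.
Qed.

Lemma kmono_riesz_weight N : kmono 3 (fun n => riesz_weight N n.+1).
Proof.
apply: (kmonoM kmono_weight); apply: kmonoM.
  exact: (kmono_shift (kmono_sqr_subn N)).
exact: kmono_const.
Qed.

Lemma cvg_riesz_weight n : riesz_weight N n @[N --> \oo] --> weight n.
Proof.
rewrite -[X in _ --> X]mulr1; apply: cvgMr.
have V0 : (N%:R : R)^-1 @[N --> \oo] --> (0 : R).
  by rewrite -cvg_shiftS; exact: cvg_harmonic.
have H1 : (1 - n%:R * N%:R^-1 : R) @[N --> \oo] --> (1 - n%:R * 0 : R).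
  by apply: cvgB; [exact: cvg_cst | exact: cvgMr].
have H : (1 - n%:R * N%:R^-1 : R) ^+ 2 @[N --> \oo] --> (1 : R).
  move: H1; rewrite mulr0 subr0 => H1; rewrite -[X in _ --> X]mulr1; exact: (cvgM H1 H1).
(* Once N > n, truncated and real subtraction coincide. *)
apply: cvg_trans H; apply: near_eq_cvg; near=> N.
have nN : (n < N)%N by near: N; exact: nbhs_infty_gt.
rewrite -exprVn -exprMn natrB ?(ltnW nN)// mulrBl divff//.
by rewrite pnatr_eq0 -lt0n; lia.
Unshelve. all: by end_near. Qed.

Lemma madelung_boxE b : madelung_box a s b = boxsum b weight.
Proof.
apply: eq_fsbigr => -[[x y] z]; rewrite inE => -[p0 _].
rewrite sgn_coordsum normsqE /weight; case: ifPn => [p1|_]; last by rewrite powRN.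
move: p1 p0; rewrite [absnsq _ == _]nsq_eq0 !absz_eq0 /=.
by move=> /and3P[/eqP-> /eqP-> /eqP->]; rewrite eqxx.
Qed.

(** The ball of squared radius [N] lies in the box with sides [N], and [riesz_weight N] vanishes on
    the rest of the box. *)
Lemma riesz_sumE N : riesz_sum a s N = boxsum (N, N, N) (riesz_weight N).
Proof.
rewrite /boxsum (@sum_box3 _ _ _ N)//; last by rewrite /riesz_weight /weight mul0r.
rewrite -sum_cube; last first.
- by move=> i j; rewrite /boxed ltnn !andbF.
- by move=> i k; rewrite /boxed ltnn andbF.
- by move=> j k; rewrite /boxed ltnn.
pose c n := (-1) ^+ n * (1 - n%:R / N%:R) ^+ 2 / (a ^+ 2 + n%:R) `^ s.
transitivity (\sum_(1 <= n < N.+1) c n * (r3 n)%:R).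
  by apply: eq_bigr => n _; rewrite /c; ring.
rewrite sum_r3 big_seq [RHS]big_seq; apply: eq_bigr => p.
rewrite mem_cube /boxed /= => ->; rewrite -/(absnsq p).
set n := absnsq p; rewrite /c /riesz_weight /weight.
case: (posnP n) => [->|n0]; first by rewrite /= mul0r mulr0.
rewrite /=; case: (leqP n N) => [nN|/ltnW]; last first.
  by rewrite -subn_eq0 => /eqP->; rewrite expr0n mul0r !mulr0.
have N0 : N%:R != 0 :> R by rewrite pnatr_eq0; lia.
rewrite powRN natrB// -exprVn -exprMn mulrBl divff//.
by rewrite -mulrA [_ ^+ 2 / _]mulrC.
Qed.

End Weights.

Theorem theorem1p1 (R : realType) (a s : R) (s_gt0 : 0 < s) :
  cvgn (riesz_sum a s) /\ madelung a s = limn (riesz_sum a s).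
Proof.
have w0 : weight a s 0 = 0 by [].
have [L HL] := boxsum_cvg w0 (kmono_weight a s_gt0) (cvg_weight a s_gt0).
have cR : riesz_sum a s N @[N --> \oo] --> L.
  rewrite (_ : riesz_sum a s = fun N => boxsum (N, N, N) (riesz_weight a s N)); last first.
    by apply/funext => N; exact: riesz_sumE.
  apply: HL => [n|n|N].
  - by near=> N; split; near: N; exact: nbhs_infty_ge.
  - exact: cvg_riesz_weight.
  - split; [exact: mul0r | exact: kmono_riesz_weight | exact: riesz_weight_le].
have cM : madelung_box a s b @[b --> (\oo, \oo, \oo)] --> L.
  rewrite (_ : madelung_box a s = fun b => boxsum b (weight a s)); last first.
    by apply/funext => b; exact: madelung_boxE.
  (* Here the filter runs over the boxes themselves and the weights stay constant. *)
  apply: (HL _ _ _ id) => [n|n|b].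
  - exists ([set c | n <= c.1 /\ n <= c.2]%N, [set k | n <= k]%N).
      split; last exact: nbhs_infty_ge.
      exists ([set k | n <= k]%N, [set k | n <= k]%N) => //.
      by split; exact: nbhs_infty_ge.
    by move=> -[[i j] k] [[/= ? ?] ?].
  - exact: cvg_cst.
  - by split=> //; exact: kmono_weight.
split; first by apply/cvg_ex; exists L.
by rewrite /madelung (cvg_lim _ cM)// (cvg_lim _ cR).
Unshelve. all: by end_near. Qed.
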